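(* Let $k\ge 4$ and $X=\{1,2,\dots,k\}$. All orbital Schreier graphs $\Gamma_w(\mathsf A_{(k)})$, $w\in X^{\omega}$, of the Hanoi Towers automaton $\mathsf A_{(k)}$ on $k$ pegs have intermediate growth.
   Context: The Hanoi Towers automaton. Let $X=\{1,\dots,k\}$ and let $X^{\omega}$ be the set of right-infinite sequences over $X$. The automaton $\mathsf A_{(k)}$ has the trivial state $e$ (acting as the identity) and one state $a_{(ij)}$ for each transposition $(i\,j)$ of $X$, $i\ne j$. The state $a_{(ij)}$ acts on $X^{\omega}$ by $a_{(ij)}(iw)=jw$, $a_{(ij)}(jw)=iw$, and $a_{(ij)}(xw)=x\,a_{(ij)}(w)$ for $x\in X\setminus\{i,j\}$, for all $w\in X^{\omega}$. Schreier graphs. Let $G_{(k)}$ be the group of transformations of $X^{\omega}$ generated by $S=\{a_{(ij)}\}$. For $w\in X^{\omega}$, $\Gamma_w(\mathsf A_{(k)})$ is the graph with vertex set the orbit $G_{(k)}(w)$, in which $u,v$ are adjacent iff $s(v)=u$ for some $s\in S\cup S^{-1}$. Growth. The growth function $\gamma_v(n)$ of a connected locally finite graph with respect to a vertex $v$ is the number of vertices in the closed ball of radius $n$ centered at $v$. Write $f\prec g$ ($f$ has growth not greater than $g$) if there is a constant $C>0$ with $f(n)\le g(Cn)$ for all $n\in\mathbb N$; $f\sim g$ (equivalent) if $f\prec g$ and $g\prec f$. The growth functions with respect to different vertices are equivalent, so one speaks of the growth of the graph. The growth is subexponential if it is not greater than $a^n$ ($a>1$) and not equivalent to it; superpolynomial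 if it is greater than every polynomial function (in the order $\prec$); intermediate if it is both superpolynomial and subexponential. *)

(* Defs.v *)
From mathcomp Require Import all_boot all_order all_algebra all_fingroup finmap.
From mathcomp Require Import boolp classical_sets cardinality reals.

Set Implicit Arguments.
Unset Strict Implicit.
Unset Printing Implicit Defensive.

Local Open Scope classical_set_scope.

Notation infword X := (nat -> X).

Definition wcons (X : Type) (x : X) (w : infword X) : infword X :=
  fun n => if n is m.+1 then w m else x.

Definition wtail (X : Type) (w : infword X) : infword X := fun n => w n.+1.

Record automaton (X : Type) := Automaton {
  astate : Type;
  aout : astate -> X -> X;
  anext : astate -> X -> astate }.

(* Letter n of q(w), where q(xw) = aout q x followed by (anext q x)(w). *)
Fixpoint act (X : Type) (A : automaton X) (q : astate A) (w : infword X)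
    (n : nat) {struct n} : X :=
  if n is m.+1 then act (anext q (w 0)) (wtail w) m else aout q (w 0).

Lemma act_cons (X : Type) (A : automaton X) (q : astate A) (x : X)
    (w : infword X) :
  act q (wcons x w) = wcons (aout q x) (act (anext q x) w).
Proof. by apply/funext => -[|n]. Qed.

Definition is_transposition (k : nat) (t : {perm 'I_k}) : bool :=
  [exists i, exists j, (i != j) && (t == tperm i j)].

Definition transposition (k : nat) := {t : {perm 'I_k} | is_transposition t}.

(* The k letters are the elements of 'I_k. [None] is the trivial state e, and
   [Some t], for t = (i j), is the state a_(ij): it applies t to the letters i
   and j and then moves to e, and copies any other letter, staying put. *)
Definition hanoi (k : nat) : automaton 'I_k :=
  {| astate := option (transposition k);
     aout := fun q x => if q is Some t then val t x else x;
     anext := fun q x =>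
       if q is Some t then (if val t x == x then Some t else None) else None |}.

Definition hanoi_gens (k : nat) : set (infword 'I_k -> infword 'I_k) :=
  range (fun t : transposition k => act (Some t : astate (hanoi k))).

Lemma act_hanoi_e (k : nat) (w : infword 'I_k) :
  act (None : astate (hanoi k)) w = w.
Proof. by apply/funext => n; elim: n w => [|n IH] w //=; rewrite IH. Qed.

Lemma act_hanoi_a (k : nat) (t : transposition k) (i j : 'I_k) :
    i != j -> val t = tperm i j -> forall w : infword 'I_k,
  let a := act (Some t : astate (hanoi k)) in
  [/\ a (wcons i w) = wcons j w, a (wcons j w) = wcons i w &
      forall x, x \notin [:: i; j] -> a (wcons x w) = wcons x (a w)].
Proof.
move=> ij tE w a; split; rewrite /a; first 2 last.
- move=> x; rewrite !inE negb_or => /andP[xi xj].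
  by rewrite act_cons /= tE tpermD 1?eq_sym// eqxx.
- by rewrite act_cons /= tE tpermL eq_sym (negbTE ij) act_hanoi_e.
- by rewrite act_cons /= tE tpermR (negbTE ij) act_hanoi_e.
Qed.

Inductive generated_group (T : Type) (S : set (T -> T)) : set (T -> T) :=
| gen_in s : S s -> generated_group S s
| gen_id : generated_group S id
| gen_comp f g : generated_group S f -> generated_group S g ->
    generated_group S (f \o g)
| gen_inv f g : generated_group S f -> cancel f g -> cancel g f ->
    generated_group S g.

Definition sym_gens (T : Type) (S : set (T -> T)) : set (T -> T) :=
  S `|` [set t | exists2 s, S s & cancel s t /\ cancel t s].

Record graph (T : Type) := Graph {
  vertices : set T;
  adjacent : T -> T -> Prop }.

Definition schreier_graph (T : Type) (S : set (T -> T)) (w : T) : graph T :=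
  {| vertices := [set g w | g in generated_group S];
     adjacent := fun u v => exists2 s, sym_gens S s & s v = u |}.

Definition hanoi_schreier_graph (k : nat) (w : infword 'I_k) :
  graph (infword 'I_k) := schreier_graph (@hanoi_gens k) w.

(* [walk G n v u] : there is a walk of length n from v to u in G. *)
Inductive walk (T : Type) (G : graph T) : nat -> T -> T -> Prop :=
| walk_nil v : vertices G v -> walk G 0 v v
| walk_cons n v x u : vertices G v -> adjacent G v x -> walk G n x u ->
    walk G n.+1 v u.

Definition closed_ball (T : Type) (G : graph T) (v : T) (n : nat) : set T :=
  [set u | exists2 m, (m <= n)%N & walk G m v u].

(* [fset_set] sends infinite sets to the empty one; this does not happen for
   the Schreier graphs above, see [finite_hanoi_ball]. *)
Definition growth (T : choiceType) (G : graph T) (v : T) (n : nat) : nat :=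
  #|` fset_set (closed_ball G v n)|.

Lemma finite_hanoi_ball (k : nat) (w v : infword 'I_k) (n : nat) :
  finite_set (closed_ball (hanoi_schreier_graph w) v n).
Proof.
pose a t := act (Some t : astate (hanoi k)).
have tK (t : transposition k) x : val t (val t x) = x.
  by have /existsP[i /existsP[j /andP[_ /eqP ->]]] := valP t; rewrite tpermK.
have aS t u m : a t u m.+1 =
    if val t (u 0) == u 0 then a t (wtail u) m else u m.+1.
  by rewrite /a /=; case: ifP => // _; rewrite act_hanoi_e.
have a_tail t u : wtail (a t u) =
    if val t (u 0) == u 0 then a t (wtail u) else wtail u.
  by apply/funext => m; rewrite /wtail aS; case: ifP.
have aK t u : a t (a t u) = u.
  apply/funext => m; elim: m u => [|m IH] u; first exact: tK.
  rewrite aS a_tail -[a t u 0]/(val t (u 0)) tK eq_sym.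
  by case: (eqVneq (val t (u 0)) (u 0)) => [e|ne]; rewrite ?IH// aS (negbTE ne).
have gensE s : sym_gens (@hanoi_gens k) s -> exists t, s = a t.
  case=> [[t _ <-]|[_ [t _ <-] [sK Ks]]]; exists t => //.
  by apply/funext => u; rewrite -[in LHS](aK t u); exact: sK.
have fin_walk m : finite_set [set u | walk (hanoi_schreier_graph w) m v u].
  elim: m v => [|m IH] x.
    by apply: (@sub_finite_set _ _ [set x]) => [u /= wu|]; [inversion wu|].
  apply: (@sub_finite_set _ _ (\bigcup_(t in [set: transposition k])
     [set u | walk (hanoi_schreier_graph w) m (a t x) u])).
    move=> u /= wu; inversion wu as [|? ? y ? _ xy wyu]; subst.
    by have [s /gensE[t ->] atx] := xy; exists t => //=; rewrite -atx aK.
  by apply: bigcup_finite => [|t _]; [exact: finite_finset|exact: IH].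
apply: (@sub_finite_set _ _ (\bigcup_(m in `I_n.+1)
   [set u | walk (hanoi_schreier_graph w) m v u])).
  by move=> u [m mn wu]; exists m.
by apply: bigcup_finite => // m _; exact: fin_walk.
Qed.

Section GrowthOrder.
Import Order.TTheory GRing.Theory Num.Theory.
Local Open Scope ring_scope.
Variable R : realType.
Implicit Types f g : nat -> R.

(* The argument n ranges over positive integers: a growth function is 1 at 0,
   so it would not dominate a polynomial p with p(0) > 1 otherwise. *)
Definition growth_le f g : Prop :=
  exists2 C : nat, (0 < C)%N & forall n : nat, (0 < n)%N -> f n <= g (C * n)%N.

Definition growth_equiv f g : Prop := growth_le f g /\ growth_le g f.

Definition growth_lt f g : Prop := growth_le f g /\ ~ growth_equiv f g.

Definition subexponential f : Prop :=
  forall a : R, 1 < a -> growth_lt f (fun n => a ^+ n).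

Definition superpolynomial f : Prop :=
  forall p : {poly R}, growth_lt (fun n => p.[n%:R]) f.

Definition intermediate f : Prop := superpolynomial f /\ subexponential f.

Definition intermediate_growth (T : choiceType) (G : graph T) : Prop :=
  forall v, vertices G v -> intermediate (fun n => (growth G v n)%:R).

End GrowthOrder.

(* Main.v *)
Require Import Defs.
From mathcomp Require Import boolp classical_sets cardinality reals.
From mathcomp Require Import all_boot all_order all_algebra perm finmap zify.

(** Letter d of a word is the peg of disc d, discs increase in size with d, and
    a generator makes at most one Hanoi move.

    Upper bound. If all discs of a set D go from a common peg p to a common peg
    p' <> p, making at most c moves each, then |D| <= M(c), where M(0) = 0 and
    M(c+1) = 1 + k M(c): when the largest disc first leaves p, all the others are
    off p, and each of them still has to move once more. So it takes
    superlinearly many steps to move each of m discs. Hence during L steps, L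
    being a large multiple of m, one of the first m discs stays on its peg p, and
    larger discs never use p. By induction on the number of usable pegs, the balls
    of radius L have at most 2^(L/r) points for suitable L, for every r.

    Lower bound. With four pegs, b j discs can be gathered on one peg in at most
    c(b) 3^j moves, since a block of b discs can be moved on the three pegs avoiding
    the smaller discs. So a ball of radius 2 c(b) 3^j has at least k^(b j) points. *)

Set Implicit Arguments.
Unset Strict Implicit.
Unset Printing Implicit Defensive.

(** * Hanoi moves restricted to a set of usable pegs *)

Section Moves.
Variable X : finType.
Implicit Types (P : {set X}) (u v z : infword X) (s : nat -> infword X).

Definition upd u d y : infword X := fun e => if e == d then y else u e.

Definition move P u v : Prop := exists d y,
  [/\ u d \in P, y \in P, y != u d,
      forall e, e < d -> u e != u d /\ u e != y & v = upd u d y].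

(** A generator may fix a word, and idle steps make [reach P n] a ball rather than a sphere. *)
Definition lazy_move P u v : Prop := v = u \/ move P u v.

Fixpoint reach P n u v : Prop :=
  if n is m.+1 then exists2 z, lazy_move P u z & reach P m z v else u = v.

Lemma lazy_moveP P u v d : lazy_move P u v -> u d != v d ->
  [/\ u d \in P, v d \in P, forall e, e < d -> u e != u d /\ u e != v d
    & forall e, e != d -> v e = u e].
Proof.
case=> [->|[d' [y [uP yP yu free ->]]]]; first by rewrite eqxx.
rewrite /upd; case: (eqVneq d d') => [-> _|]; last by rewrite eqxx.
by split=> // e /negbTE ->.
Qed.

Lemma lazy_move_sym P u v : lazy_move P u v -> lazy_move P v u.
Proof.
case=> [->|[d [y [uP yP yu free ->]]]]; first by left.
right; exists d, (u d); rewrite /upd eqxx; split=> //; first by rewrite eq_sym.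
  move=> e ed; rewrite (ltn_eqF ed); have [] := free e ed; by split.
by apply/funext => e; case: eqP => // ->.
Qed.

Lemma reach_trans P m n u v z :
  reach P m u v -> reach P n v z -> reach P (m + n) u z.
Proof.
elim: m u => [u -> //|m IH u [x ux xv] vz].
by exists x => //; exact: IH.
Qed.

Lemma reach_add P m n u z :
  reach P (m + n) u z -> exists2 v, reach P m u v & reach P n v z.
Proof.
elim: m u => [u uz|m IH u [x ux /IH[v xv vz]]]; first by exists u.
by exists v => //; exists x.
Qed.

Lemma reach_refl P n u : reach P n u u.
Proof. by elim: n => //= n IH; exists u => //; left. Qed.

Lemma reach_le P m n u v : m <= n -> reach P m u v -> reach P n u v.
Proof.
move=> /subnKC <- uv; apply: reach_trans uv _; exact: reach_refl.
Qed.

Lemma reach_move P u v : move P u v -> reach P 1 u v.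
Proof. by exists v => //; right. Qed.

Lemma reach_sym P n u v : reach P n u v -> reach P n v u.
Proof.
elim: n u v => [u v -> //|n IH u v [x ux /IH vx]].
rewrite -addn1; apply: reach_trans vx _.
by exists u => //; exact: lazy_move_sym.
Qed.

Lemma reach_path P n u v : reach P n u v ->
  exists s, [/\ s 0 = u, s n = v & forall t, lazy_move P (s t) (s t.+1)].
Proof.
elim: n u => [u ->|n IH u [x ux /IH[s [s0 sn ps]]]].
  by exists (fun=> v); split => // t; left.
exists (fun t => if t is t'.+1 then s t' else u); split=> // -[|t] //.
by rewrite s0.
Qed.

Lemma path_reach P s n :
  (forall t, t < n -> lazy_move P (s t) (s t.+1)) -> reach P n (s 0) (s n).
Proof.
elim: n s => // n IH s ps; exists (s 1); first exact: ps.
by apply: (IH (fun t => s t.+1)) => t tn; exact: ps.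
Qed.

Lemma path_inactive P s d t : (forall t, lazy_move P (s t) (s t.+1)) ->
  s 0 d \notin P -> s t d = s 0 d.
Proof.
move=> ps nP; elim: t => // t IH; apply/eqP; apply: contraT.
rewrite -IH eq_sym => /(lazy_moveP (ps t))[]; by rewrite IH (negbTE nP).
Qed.

End Moves.

(** * Counting the moves of single discs along a path *)

Lemma last_switch (Q : pred nat) a b : a <= b -> Q a -> ~~ Q b ->
  exists2 t, a <= t < b & Q t && ~~ Q t.+1.
Proof.
elim: b => [|b IH] ab Qa Qb; first by case: a ab Qa Qb => // _ ->.
case: (boolP (Q b)) => [Qb'|/negP nQb].
  case: (ltngtP a b.+1) ab => // [ab _|ab _]; last by rewrite -ab Qa in Qb.
  by exists b; [lia|rewrite Qb' Qb].
have ab' : a <= b by rewrite -ltnS ltn_neqAle ab andbT; apply: contraNneq Qb => <-.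
have [|t tab Qt] := IH ab' Qa; first exact/negP.
by exists t => //; lia.
Qed.

Section MoveCount.
Variables (X : finType) (s : nat -> infword X).
Hypothesis ps : forall t, lazy_move setT (s t) (s t.+1).

Definition nmoves d a b := \sum_(a <= t < b) (s t d != s t.+1 d).

Lemma nmoves_cat d a t b : a <= t -> t <= b ->
  nmoves d a b = nmoves d a t + nmoves d t b.
Proof. by move=> ? ?; rewrite /nmoves (big_cat_nat (n := t)). Qed.

Lemma nmoves_gt0 d a b : a <= b -> s a d != s b d -> 0 < nmoves d a b.
Proof.
move=> ab sab.
have [||t /andP[at_ tb] /andP[/eqP st st']] :=
  @last_switch (fun t => s t d == s a d) a b ab.
- by rewrite eqxx.
- by rewrite eq_sym.
rewrite (@nmoves_cat d a t b)// ?(ltnW tb)// (@nmoves_cat d t t.+1 b)//.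
by rewrite [nmoves d t t.+1]big_nat1 st eq_sym st' addnCA.
Qed.

Fixpoint max_transfer c := if c is c'.+1 then (#|X| * max_transfer c').+1 else 0.

(** The time window is arbitrary because the induction on [c] shrinks it. *)
Definition transfer_bound c := forall N (D : {set 'I_N}) a b p p', a <= b ->
  p != p' ->
  {in D, forall d : 'I_N, [/\ s a d = p, s b d = p' & nmoves d a b <= c]} ->
  #|D| <= max_transfer c.

(** Sorting the discs by their peg at time [b] gives at most [#|X|] nonempty classes, each of which
    is transferred from [p] to one other peg. *)
Lemma spread_bound c N (D : {set 'I_N}) a b p : transfer_bound c -> a <= b ->
  {in D, forall d : 'I_N, [/\ s a d = p, s b d != p & nmoves d a b <= c]} ->
  #|D| <= #|X| * max_transfer c.
Proof.
move=> IH ab HD.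
have -> : #|D| = \sum_(x : X) #|[set d in D | s b d == x]|.
  rewrite -sum1_card (partition_big (fun d : 'I_N => s b d) predT) //=.
  apply: eq_bigr => x _; rewrite -sum1_card.
  by apply: eq_bigl => d; rewrite inE.
rewrite -sum_nat_const; apply: leq_sum => x _.
case: (set_0Vmem [set d in D | s b d == x]) => [->|[d]]; first by rewrite cards0.
rewrite inE => /andP[dD /eqP sd].
apply: (IH _ _ a b p x ab); first by have [_ + _] := HD d dD; rewrite sd eq_sym.
by move=> e; rewrite inE => /andP[/HD[? ? ?] /eqP ?].
Qed.

(** A disc can leave [p] only when no smaller disc lies on [p]; [t] is the time just before such a
    move of the largest disc [d0]. *)
Lemma departure N (D : {set 'I_N}) a b p (d0 : 'I_N) : a <= b -> d0 \in D ->
  (forall d : 'I_N, d \in D -> d <= d0) ->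
  {in D, forall d : 'I_N, s a d = p} -> s b d0 != p ->
  exists2 t, a <= t < b &
    s t d0 = p /\ {in D :\ d0, forall d : 'I_N, s t d != p}.
Proof.
move=> ab d0D d0max Dp sb.
have [||t tab /andP[/eqP st st']] :=
  @last_switch (fun t => s t d0 == p) a b ab.
- by rewrite Dp.
- by [].
exists t => //; split=> // d; rewrite !inE => /andP[dd0 /d0max dle].
have [|_ _ free _] := @lazy_moveP _ _ _ _ d0 (ps t).
  by rewrite st eq_sym.
by rewrite -{1}st; apply: (free d _).1; rewrite ltn_neqAle dle andbT.
Qed.

Lemma max_disc N (D : {set 'I_N}) d : d \in D ->
  exists2 d0, d0 \in D & forall d : 'I_N, d \in D -> d <= d0.
Proof.
by move=> dD; case: (@arg_maxnP _ d (mem D) val dD) => d0 d0D max; exists d0.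
Qed.

Lemma transfer c : transfer_bound c.
Proof.
elim: c => [|c IH] N D a b p p' ab pp' HD.
  rewrite leqn0 cards_eq0; apply/eqP/setP => d; rewrite inE; apply/negP.
  move=> /HD[sa sb]; apply/negP; rewrite -ltnNge; apply: nmoves_gt0 => //.
  by rewrite sa sb.
case: (set_0Vmem D) => [->|[d /max_disc[d0 d0D d0max]]]; first by rewrite cards0.
have [sa sb _] := HD _ d0D.
have [||t /andP[at_ tb] [st tD]] := @departure N D a b p d0 ab d0D d0max.
- by move=> e /HD[].
- by rewrite sb eq_sym.
rewrite (cardsD1 d0) d0D /= ltnS; apply: (@spread_bound c _ _ a t p) => // e eD.
have [] := HD e _; first by move: eD; rewrite inE => /andP[].
move=> sae sbe; rewrite (@nmoves_cat e a t b)// ?(ltnW tb)// => le_c.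
split=> //; first exact: tD.
(* The largest disc d0 still has to arrive at p' after time t, and e is not
   on p' when it does. *)
have [||t' /andP[tt' t'b] /andP[st' /negPn /eqP st1']] :=
  @last_switch (fun t => s t d0 != p') t b (ltnW tb).
- by rewrite st.
- by rewrite sb eqxx.
have [|_ _ free _] := @lazy_moveP _ _ _ _ d0 (ps t'); first by rewrite st1'.
have et' : s t' e != p'.
  rewrite -st1'; apply: (free e _).2; move: eD; rewrite !inE => /andP[ed0 /d0max].
  by rewrite [in X in _ -> X]ltn_neqAle ed0.
have := @nmoves_gt0 e t' b (ltnW t'b); rewrite sbe => /(_ et').
by move: le_c; rewrite (@nmoves_cat e t t' b)// ?(ltnW t'b)//; lia.
Qed.

(** When the largest disc leaves [p], the others are spread over the other pegs, so [spread_bound]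
    applies up to that time. Discs may return to [p] later, hence no final peg is prescribed. *)
Lemma stack_bound c N (D : {set 'I_N}) b p :
  {in D, forall d : 'I_N, [/\ s 0 d = p, nmoves d 0 b <= c
    & exists2 t, t <= b & s t d != p]} ->
  #|D| <= max_transfer c.+1.
Proof.
move=> HD.
case: (set_0Vmem D) => [->|[d /max_disc[d0 d0D d0max]]]; first by rewrite cards0.
have [_ _ [b' b'b sb']] := HD _ d0D.
have [|t /andP[_ tb] [st tD]] :=
  @departure N D 0 b' p d0 (leq0n _) d0D d0max _ sb'.
- by move=> e /HD[].
rewrite (cardsD1 d0) d0D ltnS.
apply: (@spread_bound c _ _ 0 t p (@transfer c)) => // e eD.
have [|? le_c _] := HD e; first by move: eD; rewrite inE => /andP[].
split=> //; first exact: tD.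
by apply: leq_trans le_c; rewrite (@nmoves_cat e 0 t b) ?leq_addr//; lia.
Qed.

Lemma sum_nmoves N b : \sum_(d < N) nmoves d 0 b <= b.
Proof.
rewrite /nmoves exchange_big /= -[leqRHS]muln1 -[X in X * _]subn0.
rewrite -sum_nat_const_nat; apply: leq_sum => t _.
case: (pickP (fun d : 'I_N => s t d != s t.+1 d)) => [d0 sd0|no].
  have [_ _ _ others] := lazy_moveP (ps t) sd0.
  rewrite (bigD1 d0)//= big1 ?addn0 ?leq_b1// => d dd0.
  by rewrite others// eqxx.
by rewrite big1// => d _; rewrite no.
Qed.

(** Few discs make at most [c] moves: grouped by starting peg, each group obeys [stack_bound]. Every
    other disc of [E] moves at least [c.+1] times, and one step moves only one disc. *)
Lemma many_moves c N (E : {set 'I_N}) b :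
  {in E, forall d : 'I_N, exists2 t, t <= b & s t d != s 0 d} ->
  c.+1 * (#|E| - #|X| * max_transfer c.+1) <= b.
Proof.
move=> HE; apply: leq_trans (sum_nmoves N b).
pose F := [set d in E | nmoves d 0 b <= c].
have leF : #|F| <= #|X| * max_transfer c.+1.
  have -> : #|F| = \sum_(x : X) #|[set d in F | s 0 d == x]|.
    rewrite -sum1_card (partition_big (fun d : 'I_N => s 0 d) predT) //=.
    apply: eq_bigr => x _; rewrite -sum1_card.
    by apply: eq_bigl => d; rewrite inE.
  rewrite -sum_nat_const; apply: leq_sum => x _.
  apply: (@stack_bound c _ _ b x) => d; rewrite !inE.
  by move=> /andP[/andP[dE dc] /eqP <-]; split=> //; exact: HE.
have FE : #|E| = #|F| + #|E :\: F|.
  rewrite -(cardsID F E); congr (#|pred_of_set _| + _).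
  by apply/setIidPr/subsetP => d; rewrite inE => /andP[].
apply: (@leq_trans (\sum_(d in E :\: F) c.+1)).
  by rewrite sum_nat_const mulnC leq_mul2r; lia.
rewrite [leqRHS](bigID (mem (E :\: F))) /= -[leqLHS]addn0 leq_add// leq_sum// => d.
by rewrite !inE => /andP[+ dE]; rewrite dE /= -ltnNge.
Qed.

End MoveCount.

(** * Upper bound: covering balls by finite lists *)

Definition covered (T : eqType) (U : T -> Prop) K :=
  exists2 l : seq T, size l <= K & forall u, U u -> u \in l.

Lemma covered_sub (T : eqType) (U V : T -> Prop) K K' :
  (forall u, U u -> V u) -> K <= K' -> covered V K -> covered U K'.
Proof.
move=> UV KK' [l lK Vl]; exists l; first exact: leq_trans KK'.
by move=> u /UV /Vl.
Qed.

Lemma covered_bigcup (I T : eqType) (l : seq I) (U : I -> T -> Prop) K :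
  (forall i, i \in l -> covered (U i) K) ->
  covered (fun u => exists2 i, i \in l & U i u) (size l * K).
Proof.
elim: l => [|i l IH] Hl; first by exists [::] => // u [].
have [|li lK Ul] := IH; first by move=> j jl; apply: Hl; rewrite inE jl orbT.
have [|lj ljK Uj] := Hl i; first by rewrite inE eqxx.
exists (lj ++ li); first by rewrite size_cat mulSn leq_add.
move=> u [j]; rewrite inE mem_cat => /predU1P[-> /Uj ->//|jl Uju].
by rewrite (Ul u) ?orbT//; exists j.
Qed.

Section Covering.
Variable X : finType.
Implicit Types (P : {set X}) (u v z : infword X).

Definition active P v d := v d \in P.

Lemma covered_letters (A : pred nat) z N :
  covered (fun u => forall e, u e != z e -> (e < N) && A e)
    (#|X| ^ count A (iota 0 N)).
Proof.
elim: N z => [|N IH] z.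
  exists [:: z] => // u Hu; rewrite inE; apply/eqP/funext => e.
  by apply/eqP; apply: contraT => /Hu.
rewrite -[in count _ _]addn1 iotaD count_cat /= addn0 add0n expnD.
have [AN|nAN] := boolP (A N); last first.
  apply: covered_sub (IH z); last by rewrite muln1.
  move=> u Hu e une; have /andP[eN Ae] := Hu e une; rewrite Ae andbT.
  by rewrite ltn_neqAle -ltnS eN andbT; apply: contraNneq nAN => <-.
pose U x u := forall e, u e != upd z N x e -> (e < N) && A e.
have := @covered_bigcup _ (infword X) (enum X) U (#|X| ^ count A (iota 0 N)).
rewrite -cardE => /(_ (fun x _ => IH (upd z N x))); apply: covered_sub; last first.
  by rewrite mulnC.
move=> u Hu; exists (u N); first by rewrite mem_enum.
move=> e; rewrite /upd; case: (eqVneq e N) => [->|eN /Hu]; first by rewrite eqxx.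
by rewrite ltnS leq_eqVlt (negbTE eN).
Qed.

(** The ball of radius [L * j.+1] is covered by balls of radius [L] around the points listed for
    radius [L * j]. *)
Lemma covered_reach_iter P L K j :
  (forall v, covered (reach P L v) K) ->
  forall v, covered (reach P (L * j) v) (K ^ j).
Proof.
move=> HK; elim: j => [|j IH] v.
  rewrite muln0; exists [:: v] => // u /= <-; exact: mem_head.
have [l lK Hl] := IH v; rewrite mulnSr expnSr.
have := covered_bigcup (fun z _ => HK z : covered (reach P L z) K).
move=> /(_ l); apply: covered_sub; last by rewrite leq_mul2r lK orbT.
by move=> u /reach_add[z /Hl zl zu]; exists z.
Qed.

(** Meant for the active discs: either some prefix contains exactly [m] of them, or there are at
    most [m] in all. *)
Lemma count_reached_or_bounded (A : pred nat) m :
  (exists N, count A (iota 0 N) = m) \/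
  (exists2 N, count A (iota 0 N) <= m & forall e, A e -> e < N).
Proof.
elim: m => [|m [[N Nm]|[N Nm HN]]]; first by left; exists 0.
  have [[e /andP[Ne Ae]]|no] := pselect (exists e, (N <= e) && A e).
    (* The prefix is extended up to the least [e] from [N] on with [A e], so exactly one place is
       gained. *)
    left; case: (ex_minnP (ex_intro (fun e => (N <= e) && A e) e _)).
      by rewrite Ne.
    move=> {Ne Ae}e /andP[Ne Ae] emin; exists e.+1.
    rewrite -(subnKC (leqW Ne)) iotaD count_cat Nm subSn// -addn1 iotaD count_cat.
    rewrite add0n subnKC// /= Ae; set c := count _ _; suff -> : c = 0 by lia.
    apply/eqP; rewrite eqn0Ngt -has_count; apply/hasPn => i.
    rewrite mem_iota => /andP[Ni iN]; apply/negP => Ai.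
    by have := emin i; rewrite Ni Ai => /(_ isT); lia.
  right; exists N; first by rewrite Nm.
  by move=> e Ae; rewrite ltnNge; apply/negP => Ne; apply: no; exists e; rewrite Ne.
by right; exists N => //; exact: leqW.
Qed.

(** Parking the discs up to [d] on [p] forgets their motion and keeps them out of the way of moves
    between other pegs. *)
Definition blank u d p : infword X := fun e => if e <= d then p else u e.

(* Discs below a disc that stays on the peg p cannot use p. *)
Lemma blank_lazy_move P u v d p : u d = p -> v d = p ->
  lazy_move P u v -> lazy_move (P :\ p) (blank u d p) (blank v d p).
Proof.
move=> ud vd uv; have [[e ne]|eq_uv] := pselect (exists e, u e != v e); last first.
  left; apply/funext => e; rewrite /blank; case: ifP => // _.
  by apply/esym/eqP; apply: contraT => ne; case: eq_uv; exists e.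
have [ueP veP free same] := lazy_moveP uv ne.
have [ed|de] := leqP e d.
  left; apply/funext => i; rewrite /blank; case: ifP => // id_.
  by apply: same; lia.
have [pu pv] := free d de; rewrite ud in pu pv.
right; exists e, (v e); rewrite /blank leqNgt de /=; split.
- by rewrite !inE eq_sym pu ueP.
- by rewrite !inE eq_sym pv veP.
- by rewrite eq_sym.
- by move=> i ie; case: ifP => // _; exact: free.
- apply/funext => i; rewrite /upd; case: (eqVneq i e) => [->|/same ->//].
  by rewrite leqNgt de.
Qed.

Lemma blank_reach P s d n : (forall t, lazy_move P (s t) (s t.+1)) ->
  (forall t, t <= n -> s t d = s 0 d) ->
  reach (P :\ s 0 d) n (blank (s 0) d (s 0 d)) (blank (s n) d (s 0 d)).
Proof.
move=> ps sd; apply: (@path_reach _ _ (fun t => blank (s t) d (s 0 d))) => t tn.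
by apply: blank_lazy_move (ps t); apply: sd => //; exact: ltnW.
Qed.

Lemma lazy_moveT P u v : lazy_move P u v -> lazy_move [set: X] u v.
Proof.
case=> [->|[d [y [uP yP yu free ->]]]]; first by left.
by right; exists d, y; split; rewrite ?inE.
Qed.

(** With enough active discs, one disc [d] among the first [m] active ones never moves. The endpoint
    is then encoded by [d], by its blanked version, reached without using the peg of [d], and by the
    letters of the active discs up to [d]. *)
Lemma covered_reach_step P L m c K v :
  L < c.+1 * (m - #|X| * max_transfer X c.+1) -> 0 < #|X| -> 0 < K ->
  (forall p z, p \in P -> covered (reach (P :\ p) L z) K) ->
  covered (reach P L v) (m.+1 * (K * #|X| ^ m)).
Proof.
move=> Lm X0 K0 HK.
have inactive s t d : (forall t, lazy_move P (s t) (s t.+1)) ->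
    s t d != s 0 d -> active P (s 0) d.
  by move=> ps; apply: contra_neqT => /(path_inactive t ps).
(* If at most [m] discs are active, only their letters can change, so [#|X| ^ m] words cover the
   ball. *)
have [[N Nm]|[N Nm HN]] := count_reached_or_bounded (active P v) m; last first.
  apply: covered_sub (covered_letters (active P v) v N); last first.
    apply: leq_trans (leq_pexp2l X0 Nm) _; rewrite mulnA leq_pmull//.
    by rewrite muln_gt0.
  move=> u /reach_path[s [s0 <- ps]] e; rewrite -[X in _ != X e]s0.
  by move=> /(inactive _ _ _ ps); rewrite s0 => Ae; rewrite HN.
pose l := filter (active P v) (iota 0 N).
have sl : size l = m by rewrite size_filter.
pose U d u := exists2 z, reach (P :\ v d) L (blank v d (v d)) z &
  forall e, u e != (if e <= d then v e else z e) -> (e < d.+1) && active P v e.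
have HU d : d \in l -> covered (U d) (K * #|X| ^ m).
  rewrite mem_filter mem_iota add0n => /and3P[dA _ dN].
  have [lz lzK Hz] := HK (v d) (blank v d (v d)) dA.
  pose W z u := forall e, u e != (if e <= d then v e else z e) ->
    (e < d.+1) && active P v e.
  have [|lu luK Hu] := @covered_bigcup _ _ lz W (#|X| ^ m).
    move=> z _; apply: covered_sub (covered_letters (active P v) _ d.+1).
      by move=> u; exact.
    by rewrite leq_pexp2l// -Nm -(subnKC dN) iotaD count_cat leq_addr.
  exists lu; first by apply: leq_trans luK _; rewrite leq_mul2r lzK orbT.
  by move=> u [z /Hz zl Wz]; apply: Hu; exists z.
have := covered_bigcup HU; rewrite sl; apply: covered_sub; last first.
  by rewrite leq_mul2r leqnSn orbT.
move=> u /reach_path[s [s0 sL ps]].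
have [[d dl sd]|allmove] :=
    pselect (exists2 d, d \in l & forall t, t <= L -> s t d = s 0 d).
  exists d => //; exists (blank u d (v d)).
    by rewrite -sL -s0; exact: blank_reach.
  move=> e; rewrite /blank -sL -s0; case: (leqP e d) => [ed|_]; last by rewrite eqxx.
  by rewrite ltnS ed; exact: inactive.
pose E := [set d : 'I_N | active P v d].
have cE : #|E| = m.
  rewrite -sl /l -val_enum_ord filter_map size_map cardE {1}/enum_mem -enumT.
  by congr size; apply: eq_filter => d; rewrite /= [LHS](_ : _ = (d \in E))// inE.
(* If all [m] active discs moved, [many_moves] would force more than [L] steps. *)
have := @many_moves X s (fun t => lazy_moveT (ps t)) c N E L.
rewrite cE => bound; suff : c.+1 * (m - #|X| * max_transfer X c.+1) <= L.
  by rewrite leqNgt Lm.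
apply: bound => d; rewrite inE => dA; apply: contrapT => no; apply: allmove.
exists (val d); first by rewrite mem_filter dA mem_iota /= add0n ltn_ord.
by move=> t tL; apply/eqP; apply: contraT => ne; case: no; exists t.
Qed.

(** After squaring, the right side is a product of two equal factors: one bounds the power of [K] by
    the hypothesis on [K], the other bounds the rest through [m.+1 * k ^ m <= 2 ^ (k.+1 * m)]. *)
Lemma subexp_arith r k m K L0 :
  0 < r -> 0 < L0 -> K ^ (2 * r) <= 2 ^ L0 ->
  (m.+1 * (K ^ (2 * r * k.+1 * m) * k ^ m)) ^ r <=
  2 ^ (L0 * (2 * r * k.+1 * m)).
Proof.
move=> r0 L00 KL; set j := _ * m.
have le_j : (m.+1 * k ^ m) ^ (2 * r) <= 2 ^ j.
  apply: (@leq_trans ((2 ^ (k.+1 * m)) ^ (2 * r))).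
    have r2 : 0 < 2 * r by rewrite muln_gt0.
    rewrite (leq_exp2r _ _ r2) [k.+1 * m]mulSn expnD.
    apply: leq_mul; first exact: ltn_expl.
    case: (posnP m) => [->|m0]; first by rewrite muln0.
    by rewrite expnM (leq_exp2r _ _ m0); apply/ltnW/ltn_expl.
  by rewrite -expnM leq_exp2l// /j; lia.
rewrite -(@leq_exp2r _ _ 2)// -expnM [r * 2]mulnC mulnCA expnMn.
rewrite -[leqRHS]mulnn leq_mul//.
  case: (posnP j) => [->|j0]; first by rewrite expn0 exp1n expn_gt0.
  by rewrite -expnM mulnC expnM [leqRHS]expnM leq_exp2r.
by apply: leq_trans le_j _; rewrite leq_exp2l// leq_pmull.
Qed.

(** The condition [K ^ r <= 2 ^ L] is [K <= 2 ^ (L / r)] in integers. Half of this exponent is spent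
    on the overhead of [covered_reach_step], so rate [r] is derived from rate [2 * r] with one peg
    fewer. *)
Lemma subexp_reach q : 0 < #|X| -> forall r, 0 < r ->
  exists L K, [/\ 0 < L, 0 < K, K ^ r <= 2 ^ L &
    forall P, #|P| <= q -> forall v, covered (reach P L v) K].
Proof.
move=> X0; elim: q => [|q IH] r r0.
  exists 1, 1; split=> //; first by rewrite exp1n.
  move=> P; rewrite leqn0 cards_eq0 => /eqP -> v.
  exists [:: v] => // u [z zv /= <-]; case: zv => [->|[d [y []]]].
    by rewrite mem_head.
  by rewrite inE.
have [|L0 [K0 [L00 K00 KL H0]]] := IH (2 * r); first by rewrite muln_gt0.
(* With [B = #|X| * max_transfer X c.+1] and [m = 2 * B], the radius chosen below equals [c * B],
   which is less than [c.+1 * (m - B)]. It is a multiple of [L0], so the smaller bound can be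
   iterated. *)
pose c := 4 * r * #|X|.+1 * L0.
have : 0 < #|X| * max_transfer X c.+1 by rewrite muln_gt0 X0.
have := fun P m L K v => @covered_reach_step P L m c K v.
move: (#|X| * max_transfer X c.+1) => B step B0.
exists (L0 * (2 * r * #|X|.+1 * (2 * B))).
exists ((2 * B).+1 * (K0 ^ (2 * r * #|X|.+1 * (2 * B)) * #|X| ^ (2 * B))).
split.
- by rewrite !muln_gt0 L00 r0 B0.
- by rewrite !muln_gt0 !expn_gt0 K00 X0.
- exact: subexp_arith.
- move=> P Pq v; apply: step => //.
  + have -> : 2 * B - B = B by lia.
    by rewrite /c mulSn; move: #|X|.+1 => k; lia.
  + by rewrite expn_gt0 K00.
  + move=> p z pP; apply: covered_reach_iter => u; apply: H0.
    by move: Pq; rewrite (cardsD1 p) pP.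
Qed.
End Covering.

(** * Lower bound: gathering discs with at least four pegs *)

Section Gathering.
Variable X : finType.
Hypothesis X4 : 4 <= #|X|.
Implicit Types (u v z : infword X).
Local Notation reach := (reach [set: X]).

Lemma fresh_peg (l : seq X) : size l < 4 -> exists y, y \notin l.
Proof.
move=> l4; apply/existsP; rewrite -[[exists _, _]]negbK negb_exists.
apply/negP => /forallP all_l; have := leq_trans l4 X4; rewrite ltnNge => /negP; apply.
apply: leq_trans (card_size l); rewrite subset_leq_card//.
by apply/subsetP => y _; have := all_l y; rewrite negbK.
Qed.

Lemma gather_block b : exists C, forall m p q u, p != q ->
  (forall e, e < m -> u e = p) ->
  reach C u (fun e => if (m <= e < m + b) && (u e != p) then q else u e).
Proof.
elim: b => [|b [C IH]].
  exists 0 => m p q u _ _ /=; apply/funext => e.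
  by rewrite addn0; case: ifP => //; lia.
exists (C + (1 + C)) => m p q u pq up.
pose d := m + b.
have [done|/norP[dp dq]] := boolP ((u d == p) || (u d == q)).
  apply: (@reach_le _ _ C) => //; first by rewrite leq_addr.
  rewrite [X in reach _ _ X](_ : _ =
    fun e => if (m <= e < m + b) && (u e != p) then q else u e); first exact: IH.
  apply/funext => e; have [->|ed] := eqVneq e d.
    rewrite /d; case/orP: done => /eqP ud; rewrite -/d ud ?eqxx ?andbF//.
    by case: ifP; case: ifP.
  have -> // : (m <= e < m + b.+1) = (m <= e < m + b).
  by apply/idP/idP; move: ed; rewrite /d; lia.
(* This is where a fourth peg is needed: the smaller discs of the block go to [y], then [d] goes to
   [q], then they follow. *)
have [y] := @fresh_peg [:: p; q; u d] isT.
rewrite !inE !negb_or => /and3P[yp yq yd].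
have py : p != y by rewrite eq_sym.
pose u1 e := if (m <= e < m + b) && (u e != p) then y else u e.
pose u2 := upd u1 d q.
have u1d : u1 d = u d by rewrite /u1 /d ltnn andbF.
apply: reach_trans (IH m p y u py up) _.
apply: (@reach_trans _ _ _ _ _ u2).
  apply: (@reach_move _ _ u1); exists d, q; rewrite !inE u1d.
  split=> //; first by rewrite eq_sym.
  move=> e ed; rewrite /u1; have [em|me] := ltnP e m.
    by rewrite /= up//; split=> //; rewrite eq_sym.
  rewrite ed /=; case: (eqVneq (u e) p) => [->|_] //=; split=> //.
  by rewrite eq_sym.
rewrite [X in reach _ _ X](_ : _ =
    fun e => if (m <= e < m + b) && (u2 e != p) then q else u2 e).
  apply: IH => // e em; rewrite /u2 /upd /u1 up//; first last.
  by rewrite eqxx andbF; case: eqP em => // ->; rewrite /d; lia.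
apply/funext => e; rewrite /u2 /upd; have [->|ed] := eqVneq e d.
  by rewrite dp addnS ltnS leq_addr leqnn ltnn andbF.
have -> : (m <= e < m + b.+1) = (m <= e < m + b).
  by apply/idP/idP; move: ed; rewrite /d; lia.
rewrite /u1; case: (boolP (m <= e < m + b)) => //= meb.
by case: (eqVneq (u e) p) => [->|_]; rewrite ?eqxx// yp.
Qed.

Definition gathered u N q : infword X := fun e => if e < N then q else u e.

(* Two rounds are needed to gather a block: one with the smaller discs on p, and
   one with them on p', for the discs of the block that lie on p. *)
Lemma gather b : exists C, forall j q u,
  reach (C * (3 ^ j).-1) u (gathered u (b * j) q).
Proof.
have [C block] := gather_block b; exists C => j.
elim: j => [|j IH] q u.
  by rewrite muln0 /gathered; apply: reach_refl.
have [p] := @fresh_peg [:: q] isT; rewrite inE => pq.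
have [p'] := @fresh_peg [:: p; q] isT; rewrite !inE negb_or => /andP[p'p p'q].
pose m := b * j.
pose u1 := gathered u m p.
pose u2 e := if (m <= e < m + b) && (u1 e != p) then q else u1 e.
pose u3 := gathered u2 m p'.
pose u4 e := if (m <= e < m + b) && (u3 e != p') then q else u3 e.
(* Three gatherings of the smaller discs and two block rounds: [C * (3 ^ j).-1] solves
   [T (j + 1) = 3 * T j + 2 * C] with [T 0 = 0]. *)
have -> : C * (3 ^ j.+1).-1 =
    C * (3 ^ j).-1 + (C + (C * (3 ^ j).-1 + (C + C * (3 ^ j).-1))).
  have : 0 < 3 ^ j by rewrite expn_gt0.
  by rewrite expnS; case: (3 ^ j) => // n _; rewrite /=; lia.
apply: reach_trans (IH p u) _.
apply: (@reach_trans _ _ _ _ _ u2).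
  by apply: block => // e em; rewrite /gathered -/m em.
apply: reach_trans (IH p' u2) _.
apply: (@reach_trans _ _ _ _ _ u4).
  by apply: block => // e em; rewrite /gathered -/m em.
rewrite [X in reach _ _ X](_ : _ = gathered u4 m q); first exact: IH.
apply/funext => e; rewrite /gathered mulnS addnC -/m.
have [em|me] := ltnP e m; first by rewrite ltn_addr.
rewrite /u4 /u3 /u2 /u1 /gathered me [e < m]ltnNge me /=.
case: (ltnP e (m + b)) => //= _; case: (eqVneq (u e) p) => [->|_] /=.
  by rewrite eq_sym p'p.
by rewrite eq_sym p'q.
Qed.

(** Both words gather to the same word, and moves are reversible. *)
Lemma reach_all b : exists C, forall j u v,
  (forall e, b * j <= e -> u e = v e) -> reach (C * 3 ^ j) u v.
Proof.
have [C gath] := gather b; exists (2 * C) => j u v uv.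
have [q _] := @fresh_peg [::] isT.
apply: (@reach_le _ _ (C * (3 ^ j).-1 + C * (3 ^ j).-1)).
  rewrite addnn -mul2n mulnA leq_mul2l leq_pred orbT//.
apply: reach_trans (gath j q u) _; apply: reach_sym.
have -> : gathered u (b * j) q = gathered v (b * j) q.
  by apply/funext => e; rewrite /gathered; case: ltnP => // /uv.
exact: gath.
Qed.

End Gathering.

(** * Generators as Hanoi moves, and balls of the Schreier graphs *)

Section HanoiMoves.
Variable k : nat.
Implicit Types (u v w : infword 'I_k) (t : transposition k).
Local Notation hanoi_act t := (act (Some t : astate (hanoi k))).

(** The automaton copies letters up to the first [i] or [j], the smallest disc on these two pegs,
    swaps that letter and becomes trivial. *)
Lemma hanoi_act_first t i j d u : i != j -> val t = tperm i j -> u d = i ->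
  (forall e, e < d -> u e != i /\ u e != j) -> hanoi_act t u = upd u d j.
Proof.
move=> ij tE; elim: d u => [|d IH] u ud free; apply/funext => -[|n].
- by rewrite /= tE ud tpermL.
- by rewrite /= tE ud tpermL eq_sym (negbTE ij) act_hanoi_e.
- by have [u0i u0j] := free 0 isT; rewrite /= tE tpermD// eq_sym.
have [u0i u0j] := free 0 isT.
rewrite /= tE tpermD 1?eq_sym// 1?eq_sym// eqxx IH// => e ed.
exact: (free e.+1).
Qed.

Lemma hanoi_act_fixed t i j u : val t = tperm i j ->
  (forall e, u e != i /\ u e != j) -> hanoi_act t u = u.
Proof.
move=> tE free; apply/funext => n; elim: n u free => [|n IH] u free.
  by have [u0i u0j] := free 0; rewrite /= tE tpermD// eq_sym.
have [u0i u0j] := free 0; rewrite /= tE tpermD 1?eq_sym// 1?eq_sym// eqxx.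
exact: (IH (wtail u) (fun e => free e.+1)).
Qed.

Lemma lazy_move_act t u : lazy_move [set: 'I_k] u (hanoi_act t u).
Proof.
have /existsP[i /existsP[j /andP[ij /eqP tE]]] := valP t.
have [ex|no] := pselect (exists e, (u e == i) || (u e == j)); last first.
  left; apply: (hanoi_act_fixed tE) => e; apply/andP; rewrite -negb_or.
  by apply/negP => ue; apply: no; exists e.
have := ex_minnP ex; case: ex_minnP => d ud dmin _.
have free e : e < d -> u e != i /\ u e != j.
  by move=> ed; apply/andP; rewrite -negb_or; apply: contraTN ed => /dmin; rewrite leqNgt.
right; exists d; case/orP: ud => /eqP ud; [exists j|exists i]; rewrite !inE ud.
  by split=> //; [rewrite eq_sym|exact: hanoi_act_first tE ud free].
split=> //; first by move=> e /free[].
apply: (@hanoi_act_first t j i); rewrite // 1?eq_sym// 1?tpermC//.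
by move=> e /free[].
Qed.

Lemma move_act u v : move [set: 'I_k] u v -> exists t, v = hanoi_act t u.
Proof.
case=> d [y [_ _ yu free ->]].
have ty : is_transposition (tperm (u d) y).
  by apply/existsP; exists (u d); apply/existsP; exists y; rewrite eq_sym yu /=.
exists (exist (fun s : {perm 'I_k} => is_transposition s) _ ty); apply/esym.
by apply: (@hanoi_act_first _ (u d) y) => //; rewrite eq_sym.
Qed.

Lemma adjacent_lazy_move w v x : adjacent (hanoi_schreier_graph w) v x ->
  lazy_move [set: 'I_k] v x.
Proof.
case=> s [[t _ <-] <-|[_ [t _ <-] [_ sK]] sx]; last first.
  by rewrite -(sK x) sx; exact: lazy_move_act.
by apply: lazy_move_sym; exact: lazy_move_act.
Qed.

Lemma move_vertex w v x : vertices (hanoi_schreier_graph w) v ->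
  move [set: 'I_k] v x -> vertices (hanoi_schreier_graph w) x.
Proof.
case=> g Gg <- /move_act[t ->]; exists (hanoi_act t \o g) => //.
by apply: gen_comp => //; apply: gen_in; exists t.
Qed.

Lemma closed_ballE w v n : vertices (hanoi_schreier_graph w) v ->
  closed_ball (hanoi_schreier_graph w) v n = reach [set: 'I_k] n v.
Proof.
move=> Gv; apply/funext => u; apply/propext; split.
  case=> m mn walk_m; apply: (reach_le mn); elim: walk_m => // i y x z _ yx _ IH.
  by exists x => //; exact: adjacent_lazy_move yx.
elim: n v Gv => [|n IH] v Gv; first by move=> /= <-; exists 0 => //; exact: walk_nil.
case=> x [->|vx xu]; first by case/IH=> // m mn W; exists m => //; exact: leqW.
have [m mn W] := IH x (move_vertex Gv vx) xu.
(* [adjacent v x] asks for a generator sending [x] to [v], so the move is reversed. *)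
case: (lazy_move_sym (or_intror vx)) => [->|/move_act[t vE]].
  by exists m => //; exact: leqW.
exists m.+1 => //; apply: walk_cons W => //.
by exists (hanoi_act t) => //; left; exists t.
Qed.

Lemma growth_le_covered w v n K : vertices (hanoi_schreier_graph w) v ->
  covered (reach [set: 'I_k] n v) K -> growth (hanoi_schreier_graph w) v n <= K.
Proof.
move=> Gv [l lK Hl]; apply: leq_trans lK; apply: uniq_leq_size.
  exact: fset_uniq.
move=> u; rewrite in_fset_set; last exact: finite_hanoi_ball.
by move=> /set_mem; rewrite closed_ballE// => /Hl.
Qed.

Lemma growth_mono w v m n : m <= n ->
  growth (hanoi_schreier_graph w) v m <= growth (hanoi_schreier_graph w) v n.
Proof.
move=> mn; apply: fsubset_leq_card; apply/fsubsetP => u.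
rewrite !in_fset_set; try exact: finite_hanoi_ball.
move=> /set_mem[i im W]; apply: mem_set; exists i => //; exact: leq_trans mn.
Qed.

Lemma growth_upper r : 0 < k -> 0 < r -> exists L K,
  [/\ 0 < L, 0 < K, K ^ r <= 2 ^ L &
    forall w v j, vertices (hanoi_schreier_graph w) v ->
    growth (hanoi_schreier_graph w) v (L * j) <= K ^ j].
Proof.
move=> k0 r0; have [|L [K [L0 K0 KL HK]]] := @subexp_reach 'I_k k _ r r0.
  by rewrite card_ord.
exists L, K; split=> // w v j Gv; apply: growth_le_covered => //.
by apply: covered_reach_iter => u; apply: HK; rewrite cardsT card_ord.
Qed.

Lemma growth_ge_expn w v n m : vertices (hanoi_schreier_graph w) v ->
  (forall u, (forall e, m <= e -> u e = v e) -> reach [set: 'I_k] n v u) ->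
  k ^ m <= growth (hanoi_schreier_graph w) v n.
Proof.
move=> Gv Hn.
pose F (f : {ffun 'I_m -> 'I_k}) : infword 'I_k :=
  fun e => if insub e is Some i then f i else v e.
have Finj : injective F.
  move=> f g fg; apply/ffunP => i; have := congr1 (fun u => u (val i)) fg.
  by rewrite /F valK.
have -> : k ^ m = size (map F (enum {: {ffun 'I_m -> 'I_k}})).
  by rewrite size_map -cardE card_ffun !card_ord.
apply: uniq_leq_size; first by rewrite map_inj_uniq ?enum_uniq.
move=> u /mapP[f _ ->]; rewrite in_fset_set; last exact: finite_hanoi_ball.
apply: mem_set; rewrite closed_ballE//; apply: Hn => e me.
by rewrite /F insubN// -leqNgt.
Qed.

Lemma growth_lower b : 4 <= k -> exists2 C, 0 < C &
  forall w v n, vertices (hanoi_schreier_graph w) v -> 0 < n ->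
  n ^ b <= growth (hanoi_schreier_graph w) v (C * n).
Proof.
move=> k4; have [|C HC] := @reach_all 'I_k _ b; first by rewrite card_ord.
(* [3 ^ j] is the least power of 3 above [n], hence at most [3 * n], which gives the factor 3; the
   successor keeps the constant positive. *)
exists (C * 3).+1 => // w v n Gv n0; pose j := (trunc_log 3 n).+1.
have n3 : n < 3 ^ j by apply: trunc_log_ltn.
have j3 : 3 ^ j <= 3 * n by rewrite expnS leq_mul2l trunc_logP.
apply: (@leq_trans (k ^ (b * j))).
  rewrite mulnC expnM; case: b HC => [//|b _].
  rewrite leq_exp2r//; apply: ltnW; apply: leq_trans n3 _.
  by rewrite leq_exp2r// ltnW.
apply: (@leq_trans (growth (hanoi_schreier_graph w) v (C * 3 ^ j))).
  by apply: growth_ge_expn Gv _ => u uv; apply: HC => e /uv.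
apply: growth_mono; rewrite mulSn -mulnA.
by apply: leq_trans (leq_addl _ _); rewrite leq_mul2l j3 orbT.
Qed.

End HanoiMoves.

(** * Comparison with polynomials and exponentials *)

Section GrowthOfReals.
Import Order.TTheory GRing.Theory Num.Theory.
Local Open Scope ring_scope.
Variable R : realType.

Lemma expr_unbounded (a : R) (M : nat) : 1 < a ->
  exists2 C, (0 < C)%N & M%:R < a ^+ C.
Proof.
move=> a1; have bern n : 1 + n%:R * (a - 1) <= a ^+ n.
  elim: n => [|n IH]; first by rewrite mul0r addr0.
  rewrite -natr1 mulrDl mul1r addrA exprS -[X in _ <= X * _](subrK 1 a).
  rewrite [leRHS]mulrDl mul1r [leRHS]addrC lerD//.
  by apply: ler_peMr; [rewrite subr_ge0 ltW|apply/exprn_ege1/ltW].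
have a0 : 0 < a - 1 by rewrite subr_gt0.
exists (Num.truncn (M%:R / (a - 1))).+1 => //; apply: lt_le_trans (bern _).
rewrite -ltrBlDl; apply: (@lt_trans _ _ M%:R); first by rewrite gtrBl.
rewrite -ltr_pdivrMr//; exact: truncnS_gt.
Qed.

Lemma horner_nat_bound (p : {poly R}) : exists B : nat,
  forall n, (0 < n)%N -> p.[n%:R] <= (B * n ^ size p)%:R.
Proof.
pose S := \sum_(i < size p) `|p`_i|.
exists (Num.truncn S).+1 => n n0; rewrite horner_coef natrM.
apply: (@le_trans _ _ (S * (n ^ size p)%:R)); last first.
  by rewrite ler_wpM2r ?ler0n// ltW// truncnS_gt.
rewrite mulr_suml ler_sum// => i _; apply: le_trans (ler_norm _) _.
rewrite normrM ler_wpM2l// -natrX normr_nat ler_nat.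
by rewrite leq_pexp2l// ltnW.
Qed.

Lemma superpolynomial_of_lower (f : nat -> nat) :
  (forall b, exists2 C, (0 < C)%N &
    forall n, (0 < n)%N -> (n ^ b <= f (C * n))%N) ->
  superpolynomial (fun n => (f n)%:R : R).
Proof.
move=> lower p; have [B HB] := horner_nat_bound p.
split=> [|[_ [C1 C10 HC1]]]; have [C C0 HC] := lower (size p).+1.
  (* Stretching the argument by [B.+1] absorbs the coefficient bound [B]. *)
  exists (C * B.+1)%N => [|n n0]; first by rewrite muln_gt0 C0.
  apply: le_trans (HB n n0) _; rewrite ler_nat -mulnA.
  apply: leq_trans (HC (B.+1 * n)%N _); last by rewrite muln_gt0.
  rewrite expnMn leq_mul//; last by rewrite leq_pexp2l.
  by rewrite expnS (leq_trans (leqnSn B))// leq_pmulr// expn_gt0.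
(* Equivalence would give [n ^ (size p).+1 <= B * (C1 * C * n) ^ size p], that is
   [n <= B * (C1 * C) ^ size p], which this [n] violates. *)
pose n := (B * (C1 * C) ^ size p).+1.
have n0 : (0 < n)%N by [].
have Cn0 : (0 < C * n)%N by rewrite muln_gt0 C0.
have := le_trans (HC1 _ Cn0) (HB _ (_ : (0 < C1 * (C * n))%N)).
rewrite muln_gt0 C10 Cn0 => /(_ isT); rewrite ler_nat => /(leq_trans (HC n n0)).
rewrite mulnA expnMn mulnA expnS leq_pmul2r ?expn_gt0// /n ltnn //.
Qed.

Lemma subexponential_of_upper (f : nat -> nat) :
  {homo f : m n / (m <= n)%N} ->
  (forall r, (0 < r)%N -> exists L K,
    [/\ (0 < L)%N, (0 < K)%N, (K ^ r <= 2 ^ L)%N & forall j, (f (L * j) <= K ^ j)%N]) ->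
  subexponential (fun n => (f n)%:R : R).
Proof.
move=> fmono upper a a1; split.
  (* Any exponential bound [K ^ n] suffices here, since the argument may be stretched until [a ^+ C]
     exceeds [K]. *)
  have [L [K [L0 K0 _ HK]]] := upper 1%N isT.
  have [C C0 KC] := expr_unbounded K a1.
  exists C => // n n0; apply: (@le_trans _ _ (K ^ n)%:R).
    by rewrite ler_nat; apply: leq_trans (HK n); apply: fmono; rewrite leq_pmull.
  by rewrite natrX exprM lerXn2r ?nnegrE ?ler0n ?exprn_ge0 ?ltW// (lt_trans _ a1).
(* Here [2 < a ^+ M]. At rate [C * M], the bound [a ^+ L <= f (C * L) <= K ^ C] would give
   [(a ^+ M) ^+ L <= K ^ (C * M) <= 2 ^ L], a contradiction. *)
move=> [_ [C C0 HC]]; have [M M0 aM] := expr_unbounded 2 a1.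
have [|L [K [L0 K0 KL HK]]] := upper (C * M)%N; first by rewrite muln_gt0 C0.
have a_ge0 : 0 <= a by apply: ltW (lt_trans ltr01 a1).
have aL : a ^+ L <= (K ^ C)%:R.
  by apply: le_trans (HC L L0) _; rewrite ler_nat mulnC.
have : (a ^+ M) ^+ L <= 2%:R ^+ L.
  rewrite -exprM mulnC exprM; apply: (le_trans (lerXn2r M _ _ aL)).
  - by rewrite nnegrE exprn_ge0.
  - by rewrite nnegrE ler0n.
  - by rewrite -!natrX -expnM ler_nat.
by apply/negP; rewrite -ltNge ltrXn2r ?ler0n// -lt0n.
Qed.

End GrowthOfReals.

Theorem theorem7 (R : realType) (k : nat) (hk : 4 <= k) (w : infword 'I_k) :
  intermediate_growth R (hanoi_schreier_graph w).
Proof.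
move=> v Gv; split.
  apply: superpolynomial_of_lower => b; have [C C0 HC] := growth_lower b hk.
  by exists C => // n n0; exact: HC.
apply: subexponential_of_upper => [m n|r r0]; first exact: growth_mono.
have [L [K [L0 K0 KL HK]]] := growth_upper (ltnW (ltnW (ltnW hk))) r0.
by exists L, K; split=> // j; exact: HK.
Qed.
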